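(* Let $A=M_1+M_2\mathbf{j}\in\mathbb{Q}_{\mathbb{R}}^{m\times n}$, $B=N_1+N_2\mathbf{j}\in\mathbb{Q}_{\mathbb{R}}^{m\times d}$, $C=R_1+R_2\mathbf{j}\in\mathbb{Q}_{\mathbb{R}}^{p\times n}$, $D=S_1+S_2\mathbf{j}\in\mathbb{Q}_{\mathbb{R}}^{p\times d}$ with complex component matrices. Assume $m\ge n+d$ and that $C^C_c$ has full row rank. Then a matrix $X\in\mathbb{C}^{n\times d}$ is a complex RBTLSE solution for $(A,B,C,D)$ if and only if it is a complex TLSE solution for $(A^C_c,B^C_c,C^C_c,D^C_c)$. Furthermore, let $X$ be a complex TLSE solution with corresponding minimizing perturbations $\widetilde{G}=[G_1^T,G_2^T]^T\in\mathbb{C}^{2m\times n}$ and $\widetilde{H}=[H_1^T,H_2^T]^T\in\mathbb{C}^{2m\times d}$, where $G_1,G_2\in\mathbb{C}^{m\times n}$ and $H_1,H_2\in\mathbb{C}^{m\times d}$. Then the corresponding minimizing perturbations in the RBTLSE problem are $$\bar{G}=G_1+G_2\mathbf{j}\in\mathbb{Q}_{\mathbb{R}}^{m\times n},\qquad \bar{H}=H_1+H_2\mathbf{j}\in\mathbb{Q}_{\mathbb{R}}^{m\times d}.$$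
   Context: $\mathbb{Q}_{\mathbb{R}}$ denotes the reduced biquaternions: the commutative real algebra with basis $1,\mathbf{i},\mathbf{j},\mathbf{k}$ and $\mathbf{j}^2=1$, $\mathbf{i}^2=\mathbf{k}^2=-1$, $\mathbf{i}\mathbf{j}=\mathbf{j}\mathbf{i}=\mathbf{k}$, $\mathbf{j}\mathbf{k}=\mathbf{k}\mathbf{j}=\mathbf{i}$, $\mathbf{k}\mathbf{i}=\mathbf{i}\mathbf{k}=-\mathbf{j}$. Identifying $\mathbb{C}=\mathbb{R}+\mathbb{R}\mathbf{i}\subset\mathbb{Q}_{\mathbb{R}}$, each $\alpha\in\mathbb{Q}_{\mathbb{R}}$ is uniquely $\beta_1+\beta_2\mathbf{j}$ with $\beta_1,\beta_2\in\mathbb{C}$, and $\|\alpha\|=\sqrt{|\beta_1|^2+|\beta_2|^2}$. For $P=(p_{ij})\in\mathbb{Q}_{\mathbb{R}}^{m\times n}$, $\|P\|_F=\sqrt{\sum_{i,j}\|p_{ij}\|^2}$. Complex matrices are regarded as reduced biquaternion matrices. For $P=P_1+P_2\mathbf{j}\in\mathbb{Q}_{\mathbb{R}}^{m\times n}$ with $P_1,P_2\in\mathbb{C}^{m\times n}$, put $P^C_c=[P_1^T,P_2^T]^T\in\mathbb{C}^{2m\times n}$. Complex RBTLSE solution for $(A,B,C,D)$: consider the problem $$\min_{X,\bar{G},\bar{H}}\|[\bar{G},\bar{H}]\|_F\quad\text{subject to}\quad (A+\bar{G})X=B+\bar{H},\quad CX=D,$$ over $X\in\mathbb{C}^{n\times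 d}$, $\bar{G}\in\mathbb{Q}_{\mathbb{R}}^{m\times n}$, $\bar{H}\in\mathbb{Q}_{\mathbb{R}}^{m\times d}$. A complex matrix $X$ that satisfies the constraints together with perturbations $\bar G,\bar H$ attaining the minimum is a complex RBTLSE solution, and such $\bar{G},\bar{H}$ are corresponding minimizing perturbations. Complex TLSE solution for $(A^C_c,B^C_c,C^C_c,D^C_c)$: consider the problem $$\min_{X,\widetilde{G},\widetilde{H}}\|[\widetilde{G},\widetilde{H}]\|_F\quad\text{subject to}\quad (A^C_c+\widetilde{G})X=B^C_c+\widetilde{H},\quad C^C_cX=D^C_c,$$ over $X\in\mathbb{C}^{n\times d}$, $\widetilde{G}\in\mathbb{C}^{2m\times n}$, $\widetilde{H}\in\mathbb{C}^{2m\times d}$. A complex matrix $X$ that satisfies the constraints together with perturbations $\widetilde G,\widetilde H$ attaining the minimum is a complex TLSE solution, and such $\widetilde{G},\widetilde{H}$ are corresponding minimizing perturbations. *)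

(* Defs.v *)
From HB Require Import structures.
From mathcomp Require Import all_boot all_order all_algebra.
From mathcomp Require Import reals complex.
From mathcomp Require Import ring.

Set Implicit Arguments.
Unset Strict Implicit.
Unset Printing Implicit Defensive.

Import Order.TTheory GRing.Theory Num.Theory.
Local Open Scope ring_scope.
Local Open Scope complex_scope.

(* [RBQ a0 a1 a2 a3] is the reduced biquaternion a0 + a1 i + a2 j + a3 k. *)
Record rbq (R : Type) := RBQ { rb0 : R; rb1 : R; rb2 : R; rb3 : R }.

Section ReducedBiquaternions.
Variable R : realType.
Local Notation Q := (rbq R).
Implicit Types (u v w : Q) (z : R[i]).

Definition rbq_to_prod u := (rb0 u, rb1 u, rb2 u, rb3 u).
Definition rbq_of_prod (t : R * R * R * R) : Q :=
  RBQ t.1.1.1 t.1.1.2 t.1.2 t.2.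
Lemma rbq_to_prodK : cancel rbq_to_prod rbq_of_prod.
Proof. by case. Qed.

HB.instance Definition _ := Equality.copy Q (can_type rbq_to_prodK).
HB.instance Definition _ := Choice.copy Q (can_type rbq_to_prodK).

Definition rbq_add u v :=
  RBQ (rb0 u + rb0 v) (rb1 u + rb1 v) (rb2 u + rb2 v) (rb3 u + rb3 v).
Definition rbq_opp u := RBQ (- rb0 u) (- rb1 u) (- rb2 u) (- rb3 u).

(* Bilinear extension of the table i^2 = k^2 = -1, j^2 = 1, ij = ji = k,
   jk = kj = i, ki = ik = -j. *)
Definition rbq_mul u v :=
  RBQ (rb0 u * rb0 v - rb1 u * rb1 v + rb2 u * rb2 v - rb3 u * rb3 v)
      (rb0 u * rb1 v + rb1 u * rb0 v + rb2 u * rb3 v + rb3 u * rb2 v)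
      (rb0 u * rb2 v + rb2 u * rb0 v - rb1 u * rb3 v - rb3 u * rb1 v)
      (rb0 u * rb3 v + rb3 u * rb0 v + rb1 u * rb2 v + rb2 u * rb1 v).

Definition rbq_scale (a : R) u :=
  RBQ (a * rb0 u) (a * rb1 u) (a * rb2 u) (a * rb3 u).

Let rbq_addA : associative rbq_add.
Proof. by move=> u v w; congr RBQ; rewrite /= addrA. Qed.
Let rbq_addC : commutative rbq_add.
Proof. by move=> u v; congr RBQ; rewrite /= addrC. Qed.
Let rbq_add0 : left_id (RBQ 0 0 0 0) rbq_add.
Proof. by case=> *; congr RBQ; rewrite /= add0r. Qed.
Let rbq_addN : left_inverse (RBQ 0 0 0 0) rbq_opp rbq_add.
Proof. by move=> u; congr RBQ; rewrite /= addNr. Qed.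
HB.instance Definition _ :=
  GRing.isZmodule.Build Q rbq_addA rbq_addC rbq_add0 rbq_addN.

Let rbq_mulA : associative rbq_mul.
Proof. by move=> u v w; congr RBQ => /=; ring. Qed.
Let rbq_mulC : commutative rbq_mul.
Proof. by move=> u v; congr RBQ => /=; ring. Qed.
Let rbq_mul1 : left_id (RBQ 1 0 0 0) rbq_mul.
Proof. by case=> *; congr RBQ => /=; ring. Qed.
Let rbq_mulD : left_distributive rbq_mul +%R.
Proof. by move=> u v w; congr RBQ => /=; ring. Qed.
Let rbq_1neq0 : RBQ 1 0 0 0 != 0 :> Q.
Proof. by apply/eqP => -[] /eqP; rewrite oner_eq0. Qed.
HB.instance Definition _ := GRing.Zmodule_isComNzRing.Build Q
  rbq_mulA rbq_mulC rbq_mul1 rbq_mulD rbq_1neq0.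

Let rbq_scaleA a b v : rbq_scale a (rbq_scale b v) = rbq_scale (a * b) v.
Proof. by congr RBQ => /=; ring. Qed.
Let rbq_scale1 : left_id 1 rbq_scale.
Proof. by case=> *; congr RBQ => /=; ring. Qed.
Let rbq_scaleDr : right_distributive rbq_scale +%R.
Proof. by move=> a u v; congr RBQ => /=; ring. Qed.
Let rbq_scaleDl v : {morph rbq_scale^~ v : a b / a + b}.
Proof. by move=> a b; congr RBQ => /=; ring. Qed.
HB.instance Definition _ := GRing.Zmodule_isLmodule.Build R Q
  rbq_scaleA rbq_scale1 rbq_scaleDr rbq_scaleDl.

Let rbq_scaleAl (a : R) (u v : Q) : a *: (u * v) = (a *: u) * v.
Proof. by congr RBQ => /=; ring. Qed.
HB.instance Definition _ := GRing.Lmodule_isLalgebra.Build R Q rbq_scaleAl.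
HB.instance Definition _ := GRing.Lalgebra_isComAlgebra.Build R Q.

Definition rbq_i : Q := RBQ 0 1 0 0.
Definition rbq_j : Q := RBQ 0 0 1 0.
Definition rbq_k : Q := RBQ 0 0 0 1.

Lemma rbq_basisE (u : Q) :
  u = rb0 u *: 1 + rb1 u *: rbq_i + rb2 u *: rbq_j + rb3 u *: rbq_k.
Proof. by case: u => *; congr RBQ => /=; ring. Qed.

Lemma rbq_table :
  [/\ rbq_i * rbq_i = -1, rbq_j * rbq_j = 1, rbq_k * rbq_k = -1
    & [/\ rbq_i * rbq_j = rbq_k, rbq_j * rbq_k = rbq_i
        & rbq_k * rbq_i = - rbq_j]].
Proof. by split; [..|split]; congr RBQ => /=; ring. Qed.

Definition rbq_of_complex z : Q := RBQ (complex.Re z) (complex.Im z) 0 0.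

Let rbq_of_complex_zmod : zmod_morphism rbq_of_complex.
Proof. by case=> [a b] [c d]; congr RBQ => /=; ring. Qed.
Let rbq_of_complex_monoid : monoid_morphism rbq_of_complex.
Proof. by split=> [//|] [a b] [c d]; congr RBQ => /=; ring. Qed.
HB.instance Definition _ :=
  GRing.isZmodMorphism.Build R[i] Q rbq_of_complex rbq_of_complex_zmod.
HB.instance Definition _ :=
  GRing.isMonoidMorphism.Build R[i] Q rbq_of_complex rbq_of_complex_monoid.

Definition rbq_pair (z1 z2 : R[i]) : Q :=
  rbq_of_complex z1 + rbq_of_complex z2 * rbq_j.

(* The complex components b1, b2 of u = b1 + b2 j. *)
Definition rbq_c1 u : R[i] := rb0 u +i* rb1 u.
Definition rbq_c2 u : R[i] := rb2 u +i* rb3 u.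

Lemma rbq_c1_pair z1 z2 : rbq_c1 (rbq_pair z1 z2) = z1.
Proof. by case: z1 z2 => [a b] [c d]; congr (_ +i* _) => /=; ring. Qed.

Lemma rbq_c2_pair z1 z2 : rbq_c2 (rbq_pair z1 z2) = z2.
Proof. by case: z1 z2 => [a b] [c d]; congr (_ +i* _) => /=; ring. Qed.

Lemma rbq_pairK u : rbq_pair (rbq_c1 u) (rbq_c2 u) = u.
Proof. by case: u => *; congr RBQ => /=; ring. Qed.

Definition rbq_norm u : R :=
  Num.sqrt (ComplexField.Normc.normc (rbq_c1 u) ^+ 2
            + ComplexField.Normc.normc (rbq_c2 u) ^+ 2).

Section Matrices.
Variables (m n : nat).

Definition mx_pair (P1 P2 : 'M[R[i]]_(m, n)) : 'M[Q]_(m, n) :=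
  map2_mx rbq_pair P1 P2.

Definition cstack (P : 'M[Q]_(m, n)) : 'M[R[i]]_(m + m, n) :=
  col_mx (map_mx rbq_c1 P) (map_mx rbq_c2 P).

Definition rbq_frob (P : 'M[Q]_(m, n)) : R :=
  Num.sqrt (\sum_i \sum_j rbq_norm (P i j) ^+ 2).

Definition cfrob (P : 'M[R[i]]_(m, n)) : R :=
  Num.sqrt (\sum_i \sum_j ComplexField.Normc.normc (P i j) ^+ 2).

Lemma cstack_pair P1 P2 : cstack (mx_pair P1 P2) = col_mx P1 P2.
Proof.
by congr col_mx; apply/matrixP => i j;
   rewrite !mxE ?rbq_c1_pair ?rbq_c2_pair.
Qed.

Lemma mx_pairK P : mx_pair (map_mx rbq_c1 P) (map_mx rbq_c2 P) = P.
Proof. by apply/matrixP => i j; rewrite !mxE rbq_pairK. Qed.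

Lemma rbq_frob_complex P : rbq_frob (map_mx rbq_of_complex P) = cfrob P.
Proof.
congr Num.sqrt; apply: eq_bigr => i _; apply: eq_bigr => j _.
rewrite mxE /rbq_norm; case: (P i j) => a b /=.
by rewrite expr0n /= addr0 sqrtr0 expr0n addr0 [Num.sqrt (_ ^+ 2)]sqrtr_sqr
           ger0_norm ?sqrtr_ge0.
Qed.

End Matrices.

Section Problems.
Variables (m n p d : nat).
Implicit Types X : 'M[R[i]]_(n, d).

Definition rbtlse_feasible (A : 'M[Q]_(m, n)) (B : 'M[Q]_(m, d))
    (C : 'M[Q]_(p, n)) (D : 'M[Q]_(p, d))
    X (G : 'M[Q]_(m, n)) (H : 'M[Q]_(m, d)) : Prop :=
  (A + G) *m map_mx rbq_of_complex X = B + H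
  /\ C *m map_mx rbq_of_complex X = D.

Definition rbtlse_minimizer A B C D X G H : Prop :=
  rbtlse_feasible A B C D X G H /\
  forall X' G' H', rbtlse_feasible A B C D X' G' H' ->
    rbq_frob (row_mx G H) <= rbq_frob (row_mx G' H').

Definition rbtlse_solution A B C D X : Prop :=
  exists G H, rbtlse_minimizer A B C D X G H.

Definition tlse_feasible (A : 'M[R[i]]_(m, n)) (B : 'M[R[i]]_(m, d))
    (C : 'M[R[i]]_(p, n)) (D : 'M[R[i]]_(p, d))
    X (G : 'M[R[i]]_(m, n)) (H : 'M[R[i]]_(m, d)) : Prop :=
  (A + G) *m X = B + H /\ C *m X = D.

Definition tlse_minimizer A B C D X G H : Prop :=
  tlse_feasible A B C D X G H /\
  forall X' G' H', tlse_feasible A B C D X' G' H' ->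
    cfrob (row_mx G H) <= cfrob (row_mx G' H').

Definition tlse_solution A B C D X : Prop :=
  exists G H, tlse_minimizer A B C D X G H.

End Problems.

End ReducedBiquaternions.

(* Main.v *)
(* For complex X, the map P |-> cstack P is an additive bijection, isometric for
   the Frobenius norms, that commutes with right multiplication by X; it turns
   one problem into the other.  The minimizing perturbations for a given X are
   unique because they form the element of least norm of an affine subspace: by
   the parallelogram identity, the midpoint of two distinct ones is shorter. *)

From HB Require Import structures.
Require Import Defs.
From mathcomp Require Import all_boot all_order all_algebra.
From mathcomp Require Import reals complex.
From mathcomp Require Import ring lra.

Import Order.TTheory GRing.Theory Num.Theory.
Local Open Scope ring_scope.
Local Open Scope complex_scope.

Section Stacking.
Set Implicit Arguments.
Unset Strict Implicit.
Context {R : realType}.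
Local Notation Q := (rbq R).
Local Notation normc := ComplexField.Normc.normc.

Fact rbq_c1_zmod : zmod_morphism (@rbq_c1 R).
Proof. by []. Qed.
HB.instance Definition _ :=
  GRing.isZmodMorphism.Build Q R[i] (@rbq_c1 R) rbq_c1_zmod.

Fact rbq_c2_zmod : zmod_morphism (@rbq_c2 R).
Proof. by []. Qed.
HB.instance Definition _ :=
  GRing.isZmodMorphism.Build Q R[i] (@rbq_c2 R) rbq_c2_zmod.

(** A complex [z] commutes with [rbq_j], so (b1 + b2 j) z = b1 z + (b2 z) j: the two components do
    not mix. *)
Lemma rbq_c1Mr (u : Q) (z : R[i]) :
  rbq_c1 (u * rbq_of_complex z) = rbq_c1 u * z.
Proof. by case: u z => a b c e [x y]; congr (_ +i* _) => /=; ring. Qed.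

Lemma rbq_c2Mr (u : Q) (z : R[i]) :
  rbq_c2 (u * rbq_of_complex z) = rbq_c2 u * z.
Proof. by case: u z => a b c e [x y]; congr (_ +i* _) => /=; ring. Qed.

Lemma cstackD (m n : nat) (P P' : 'M[Q]_(m, n)) :
  cstack (P + P') = cstack P + cstack P'.
Proof. by rewrite /cstack !map_mxD add_col_mx. Qed.

(** This is where the restriction to complex [X] enters: a [j] part of [X] would send each component
    of [P] into the other. *)
Lemma cstackMr (m n d : nat) (P : 'M[Q]_(m, n)) (X : 'M[R[i]]_(n, d)) :
  cstack (P *m map_mx (@rbq_of_complex R) X) = cstack P *m X.
Proof.
rewrite /cstack mul_col_mx; congr (col_mx _ _); apply/matrixP => i j;
  rewrite !mxE raddf_sum /=; apply: eq_bigr => k _;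
  by rewrite !mxE ?rbq_c1Mr ?rbq_c2Mr.
Qed.

(** Two-sided inverse of [cstack]; it makes every complex perturbation of the stacked data come from
    a reduced biquaternion one. *)
Definition cunstack (m n : nat) (P : 'M[R[i]]_(m + m, n)) : 'M[Q]_(m, n) :=
  mx_pair (usubmx P) (dsubmx P).

Lemma cunstackK (m n : nat) : cancel (@cunstack m n) (@cstack R m n).
Proof. by move=> P; rewrite /cunstack cstack_pair vsubmxK. Qed.

Lemma cstackK (m n : nat) : cancel (@cstack R m n) (@cunstack m n).
Proof. by move=> P; rewrite /cunstack col_mxKu col_mxKd mx_pairK. Qed.

Lemma cstack_inj (m n : nat) : injective (@cstack R m n).
Proof. exact: can_inj (@cstackK m n). Qed.

Lemma rbq_norm_sqr (u : Q) :
  rbq_norm u ^+ 2 = normc (rbq_c1 u) ^+ 2 + normc (rbq_c2 u) ^+ 2.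
Proof. by rewrite sqr_sqrtr // addr_ge0 ?sqr_ge0. Qed.

Lemma rbq_frob_cstack (m n : nat) (P : 'M[Q]_(m, n)) :
  rbq_frob P = cfrob (cstack P).
Proof.
congr Num.sqrt; rewrite big_split_ord /= -big_split /=.
apply: eq_bigr => i _; rewrite -big_split /=; apply: eq_bigr => j _.
by rewrite rbq_norm_sqr col_mxEu col_mxEd !mxE.
Qed.

Lemma cstack_row_mx (m n d : nat) (G : 'M[Q]_(m, n)) (H : 'M[Q]_(m, d)) :
  cstack (row_mx G H) = row_mx (cstack G) (cstack H).
Proof. by rewrite /cstack !map_row_mx -block_mxEv block_mxEh. Qed.

Section Equivalence.
Context {m n p d : nat}.
Variables (A : 'M[Q]_(m, n)) (B : 'M[Q]_(m, d)).
Variables (C : 'M[Q]_(p, n)) (D : 'M[Q]_(p, d)).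

Lemma rbtlse_feasible_cstack X G H :
  rbtlse_feasible A B C D X G H <->
  tlse_feasible (cstack A) (cstack B) (cstack C) (cstack D) X
    (cstack G) (cstack H).
Proof.
rewrite /rbtlse_feasible /tlse_feasible -!cstackD -!cstackMr.
by split=> -[AB CD]; split;
  [congr cstack|congr cstack|apply: cstack_inj|apply: cstack_inj].
Qed.

Lemma rbtlse_minimizer_cstack X G H :
  rbtlse_minimizer A B C D X G H <->
  tlse_minimizer (cstack A) (cstack B) (cstack C) (cstack D) X
    (cstack G) (cstack H).
Proof.
split=> -[feas min]; split; try exact/rbtlse_feasible_cstack.
  (* Surjectivity of [cstack]: an arbitrary competitor of the stacked problem is written as a stack
     before it is carried back. *)
  move=> X' G' H'; rewrite -(cunstackK G') -(cunstackK H').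
  by move=> /rbtlse_feasible_cstack /min; rewrite !rbq_frob_cstack !cstack_row_mx.
move=> X' G' H' /rbtlse_feasible_cstack /min.
by rewrite !rbq_frob_cstack !cstack_row_mx.
Qed.

Lemma rbtlse_solution_cstack X :
  rbtlse_solution A B C D X <->
  tlse_solution (cstack A) (cstack B) (cstack C) (cstack D) X.
Proof.
split=> -[G [H min]].
  by exists (cstack G), (cstack H); apply/rbtlse_minimizer_cstack.
exists (cunstack G), (cunstack H); apply/rbtlse_minimizer_cstack.
by rewrite !cunstackK.
Qed.

End Equivalence.

Lemma normc_sqr (z : R[i]) :
  normc z ^+ 2 = complex.Re z ^+ 2 + complex.Im z ^+ 2.
Proof. by case: z => x y /=; rewrite sqr_sqrtr // addr_ge0 ?sqr_ge0. Qed.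

Lemma cfrob_sqr (m n : nat) (P : 'M[R[i]]_(m, n)) :
  cfrob P ^+ 2 = \sum_i \sum_j normc (P i j) ^+ 2.
Proof.
by rewrite sqr_sqrtr // sumr_ge0 // => i _; rewrite sumr_ge0 // => j _; exact: sqr_ge0.
Qed.

Lemma cfrob_eq0 (m n : nat) (P : 'M[R[i]]_(m, n)) : cfrob P = 0 -> P = 0.
Proof.
move=> P0; have /eqP := cfrob_sqr P; rewrite P0 expr0n /= eq_sym.
rewrite psumr_eq0 => [/allP Pi0|i _]; last first.
  by rewrite sumr_ge0 // => j _; exact: sqr_ge0.
apply/matrixP => i j; move: (Pi0 i (mem_index_enum i)) => /=.
rewrite psumr_eq0 => [/allP/(_ j (mem_index_enum j))|k _]; last exact: sqr_ge0.
by rewrite sqrf_eq0 mxE => /eqP; exact: ComplexField.Normc.eq0_normc.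
Qed.

(** An embedded real rather than an inverse in [R[i]], so that real and imaginary parts of multiples
    reduce to expressions in [R]. *)
Local Notation half := ((2^-1 : R)%:C).

(** The parallelogram identity divided by 4; it holds entry by entry, as an identity in four real
    coordinates. *)
Lemma cfrob_midpoint (m n : nat) (P P' : 'M[R[i]]_(m, n)) :
  cfrob (half *: (P + P')) ^+ 2 + cfrob (P - P') ^+ 2 / 4 =
  (cfrob P ^+ 2 + cfrob P' ^+ 2) / 2.
Proof.
rewrite !cfrob_sqr -big_split /= !mulr_suml -big_split /=.
apply: eq_bigr => i _; rewrite -big_split /= !mulr_suml -big_split /=.
apply: eq_bigr => j _; rewrite !mxE !normc_sqr.
by case: (P i j) (P' i j) => [a b] [a' b'] /=; field.
Qed.

Lemma tlse_minimizer_unique (m n p d : nat)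
    (A : 'M[R[i]]_(m, n)) (B : 'M[R[i]]_(m, d))
    (C : 'M[R[i]]_(p, n)) (D : 'M[R[i]]_(p, d)) X G H G' H' :
  tlse_minimizer A B C D X G H -> tlse_minimizer A B C D X G' H' ->
  G = G' /\ H = H'.
Proof.
move=> [[AG CX] min] [[AG' CX'] min'].
have half2 : half + half = 1 by rewrite -rmorphD /= -[RHS]/(1%:C); congr _%:C; field.
(* Splitting [A] and [B] into halves exhibits the midpoint equation as the average of the two given
   ones, which share the same [X]. *)
have splitE q (P : 'M[R[i]]_(m, q)) : P = half *: P + half *: P.
  by rewrite -scalerDl half2 scale1r.
have midfeas : tlse_feasible A B C D X (half *: (G + G')) (half *: (H + H')).
  split=> //; rewrite [A in LHS]splitE [B]splitE -!scalerDr -scalemxAl.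
  by rewrite addrACA mulmxDl AG AG' addrACA.
have le_mid := min _ _ _ midfeas.
have le_GG' := min _ _ _ (conj AG' CX').
have le_G'G := min' _ _ _ (conj AG CX).
have frobE : cfrob (row_mx G H) = cfrob (row_mx G' H').
  by apply/eqP; rewrite eq_le le_GG' le_G'G.
have := cfrob_midpoint (row_mx G H) (row_mx G' H').
rewrite add_row_mx scale_row_mx -frobE.
have le_sqr : cfrob (row_mx G H) ^+ 2 <=
    cfrob (row_mx (half *: (G + G')) (half *: (H + H'))) ^+ 2.
  by rewrite lerXn2r ?nnegrE ?sqrtr_ge0.
move=> midE; have diff0 : cfrob (row_mx G H - row_mx G' H') ^+ 2 = 0.
  (* With N the common norm, [midE] says that the squared midpoint norm plus a quarter of the
     squared difference is N^2, while [le_sqr] bounds the former below by N^2. *)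
  by apply: le_anti; rewrite sqr_ge0 andbT; lra.
move/eqP: diff0; rewrite sqrf_eq0 => /eqP/cfrob_eq0/eqP.
by rewrite subr_eq0 => /eqP/eq_row_mx.
Qed.

End Stacking.

Theorem theorem4p1 (R : realType) (m n p d : nat)
    (M1 M2 : 'M[R[i]]_(m, n)) (N1 N2 : 'M[R[i]]_(m, d))
    (R1 R2 : 'M[R[i]]_(p, n)) (S1 S2 : 'M[R[i]]_(p, d))
    (A : 'M[rbq R]_(m, n)) (B : 'M[rbq R]_(m, d))
    (C : 'M[rbq R]_(p, n)) (D : 'M[rbq R]_(p, d)) :
  A = mx_pair M1 M2 -> B = mx_pair N1 N2 ->
  C = mx_pair R1 R2 -> D = mx_pair S1 S2 ->
  (n + d <= m)%N ->
  row_free (cstack C) ->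
  (forall X : 'M[R[i]]_(n, d),
     rbtlse_solution A B C D X <->
     tlse_solution (cstack A) (cstack B) (cstack C) (cstack D) X)
  /\
  (forall (X : 'M[R[i]]_(n, d))
          (G1 G2 : 'M[R[i]]_(m, n)) (H1 H2 : 'M[R[i]]_(m, d)),
     tlse_minimizer (cstack A) (cstack B) (cstack C) (cstack D) X
       (col_mx G1 G2) (col_mx H1 H2) ->
     forall (G : 'M[rbq R]_(m, n)) (H : 'M[rbq R]_(m, d)),
       rbtlse_minimizer A B C D X G H <->
       G = mx_pair G1 G2 /\ H = mx_pair H1 H2).
Proof.
move=> _ _ _ _ _ _; split=> [X|X G1 G2 H1 H2 min G H].
  exact: rbtlse_solution_cstack.
(* Both directions compare stacks: uniqueness identifies those of [G] and [H] with the given blocks,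
   and conversely the pairs stack back to these blocks. *)
rewrite rbtlse_minimizer_cstack; split=> [min'|[-> ->]].
  have [GE HE] := tlse_minimizer_unique min' min.
  by split; apply: cstack_inj; rewrite cstack_pair.
by rewrite !cstack_pair.
Qed.
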